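(* Let $n\ge 3$ and let $(A,b,c)$ with $A\in\mathbb{R}^{n\times n}$, $b\in\mathbb{R}^n$, $c\in\mathbb{R}^{1\times n}$ be a minimal realization with impulse response $g$, and suppose $\lambda_1(A)\ne\lambda_2(A)\neq\lambda_3(A)$ (i.e. $\lambda_1(A)\neq\lambda_2(A)$ and $\lambda_2(A)\neq\lambda_3(A)$). (a) If the Hankel operator $\mathcal{H}_g$ is $1$-variation bounding, then $\lambda_1(A)$ and $\lambda_2(A)$ are real and $\lambda_1(A)>\lambda_2(A)\ge0$. (b) If $\mathcal{H}_g$ is strictly $1$-variation bounding, then $\lambda_1(A)$ and $\lambda_2(A)$ are real and $\lambda_1(A)>\lambda_2(A)>0$.
   Context: A triple $(A,b,c)$ denotes the discrete-time linear system $x(t+1)=Ax(t)+bu(t)$, $y(t)=cx(t)$; its impulse response is $g(t)=cA^{t-1}b$ for $t\ge1$ and $g(t)=0$ for $t\le0$. It is a minimal realization if it is controllable and observable. The eigenvalues $\lambda_1(A),\dots,\lambda_n(A)$ of $A$ (counted with multiplicity) are ordered by descending absolute value; eigenvalues of equal magnitude are sub-sorted by decreasing real part. The Hankel operator is $(\mathcal{H}_g u)(t)=\sum_{\tau=1}^{\infty}g(t+\tau)u(-\tau)$, $t\ge0$, acting on real sequences $(u(-\tau))_{\tau\ge1}$ for which these sums converge. For a real vector or sequence $u$, $S^-(u)$ is the number of sign changes in $u$ after deleting all zero entries, with $S^-(0):=-1$; $S^+(u)$ is the maximal number of sign changes obtainable by replacing each zero entry of $u$ by some real number. A linear map $X$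 is (strictly) $k$-variation bounding if for all $u\ne0$ with $S^-(u)\le k$ one has $S^-(Xu)\le k$ (resp. $S^+(Xu)\le k$). *)

(* Defs.v *)
From HB Require Import structures.
From mathcomp Require Import all_boot all_order all_algebra.
From mathcomp Require Import all_classical all_reals all_analysis.
From mathcomp Require Import complex.

Set Implicit Arguments.
Unset Strict Implicit.
Unset Printing Implicit Defensive.

Import Order.TTheory GRing.Theory Num.Theory.
Import numFieldNormedType.Exports.

Local Open Scope classical_set_scope.
Local Open Scope ring_scope.

Fixpoint state (R : realType) (n : nat) (A : 'M[R]_n) (b : 'cV[R]_n)
    (x0 : 'cV[R]_n) (u : nat -> R) (t : nat) : 'cV[R]_n :=
  if t is s.+1 then A *m state A b x0 u s + u s *: b else x0.

Definition output (R : realType) (n : nat) (A : 'M[R]_n) (b : 'cV[R]_n)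
    (c : 'rV[R]_n) (x0 : 'cV[R]_n) (u : nat -> R) (t : nat) : R :=
  (c *m state A b x0 u t) 0 0.

Definition controllable (R : realType) (n : nat) (A : 'M[R]_n)
    (b : 'cV[R]_n) : Prop :=
  forall x0 x1 : 'cV[R]_n,
    exists (T : nat) (u : nat -> R), state A b x0 u T = x1.

Definition observable (R : realType) (n : nat) (A : 'M[R]_n) (b : 'cV[R]_n)
    (c : 'rV[R]_n) : Prop :=
  forall (u : nat -> R) (x0 x0' : 'cV[R]_n),
    (forall t, output A b c x0 u t = output A b c x0' u t) -> x0 = x0'.

Definition minimal_realization (R : realType) (n : nat) (A : 'M[R]_n)
    (b : 'cV[R]_n) (c : 'rV[R]_n) : Prop :=
  controllable A b /\ observable A b c.

(* Only the times t >= 0 are represented. *)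
Definition impulse_response (R : realType) (n : nat) (A : 'M[R]_n)
    (b : 'cV[R]_n) (c : 'rV[R]_n) (t : nat) : R :=
  if t is s.+1 then (c *m A ^+ s *m b) 0 0 else 0.

(* An input u(-1), u(-2), ... on the negative half-axis is stored as the
   sequence v with v j = u(-(j + 1)); the summation index is tau = j + 1. *)
Definition hankel_terms (R : realType) (g : nat -> R) (v : nat -> R)
    (t : nat) : nat -> R :=
  fun j => g (t + j.+1)%N * v j.

Definition hankel_dom (R : realType) (g : nat -> R) : set (nat -> R) :=
  [set v | forall t, cvgn (series (hankel_terms g v t))].

Definition hankel (R : realType) (g : nat -> R) (v : nat -> R) : nat -> R :=
  fun t => limn (series (hankel_terms g v t)).

(* The places where the sign changes once the zero entries are deleted. *)
Definition sign_changes (R : realType) (u : nat -> R) : set (nat * nat) :=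
  [set p | [/\ (p.1 < p.2)%N, u p.1 * u p.2 < 0 &
     forall k, (p.1 < k < p.2)%N -> u k = 0]].

(* The value is extended real because a sequence may change sign infinitely
   often. *)
Definition Sminus (R : realType) (u : nat -> R) : \bar R :=
  if `[< u = (fun=> 0) >] then (-1)%:E else counting (sign_changes u).

Definition Splus (R : realType) (u : nat -> R) : \bar R :=
  ereal_sup [set Sminus w | w in [set w : nat -> R |
    forall i, u i != 0 -> w i = u i]].

(* X is an operator on sequences defined on D; its values outside D are
   irrelevant. *)
Definition variation_bounding (R : realType) (k : nat) (D : set (nat -> R))
    (X : (nat -> R) -> nat -> R) : Prop :=
  forall u, D u -> u <> (fun=> 0) ->
    (Sminus u <= k%:R%:E)%E -> (Sminus (X u) <= k%:R%:E)%E.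

Definition strictly_variation_bounding (R : realType) (k : nat)
    (D : set (nat -> R)) (X : (nat -> R) -> nat -> R) : Prop :=
  forall u, D u -> u <> (fun=> 0) ->
    (Sminus u <= k%:R%:E)%E -> (Splus (X u) <= k%:R%:E)%E.

Definition eig_geq (R : realType) (z w : R[i]) : bool :=
  (`|w| < `|z|) || ((`|w| == `|z|) && (complex.Re w <= complex.Re z)).

(* lam lists the complex eigenvalues of A with algebraic multiplicity, in the
   prescribed order. Ties between eigenvalues of equal modulus and equal real
   part (complex conjugates) may be broken either way, so that lam need not be
   unique. *)
Definition ordered_eigenvalues (R : realType) (n : nat) (A : 'M[R]_n)
    (lam : seq R[i]) : Prop :=
  char_poly (map_mx (real_complex R) A) = \prod_(z <- lam) ('X - z%:P) /\
  sorted (@eig_geq R) lam.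

(* Main.v *)
Require Import Defs.
From HB Require Import structures.
From mathcomp Require Import all_boot all_order all_algebra.
From mathcomp Require Import all_classical all_reals all_analysis.
From mathcomp Require Import complex.
From mathcomp Require Import ring lra zify.

Import Order.TTheory GRing.Theory Num.Theory.
Import numFieldNormedType.Exports.

(** Write h_t = c A^t b and phi f = c f(A) b, a linear functional on complex
    polynomials with phi 'X^t = h_t.  Minimality says that all the moments
    phi ('X^t * f) vanish if and only if the characteristic polynomial chi
    divides f ([moment_annihilator]).

    An input supported on the two most recent instants has at most one sign
    change, so its image, the sequence al h_t + be h_(t+1) = phi ('X^t * p) with
    p = al + be 'X, has finitely many sign changes and is eventually of one sign
    ([two_tap_output_eventually_signed]).

    Positivity forces a dominant positive pole (a theorem of Pringsheim, here
    [dominant_modulus_is_root]).  Let chi = q p, where q has the roots l, let mu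
    be a root in l of largest modulus r > 0, and suppose phi ('X^t * p) >= 0 for
    large t.  The power series sum_t phi ('X^t * p) x^t is rational, its poles
    are the inverses of the nonzero roots of q, and all but finitely many of its
    coefficients are nonnegative.  If r were not in l, the series would stay
    bounded as x increases to 1 / r, hence bounded on the open disc of radius
    1 / r, which contradicts the pole at 1 / mu.  So r belongs to l.

    With p = 1 and l all the eigenvalues, |lambda_1| is an eigenvalue; as
    eigenvalues of equal modulus are sorted by decreasing real part,
    lambda_1 = |lambda_1|.  With p = 'X - lambda_1, now a real polynomial, and
    l = lambda_2, ..., lambda_n, the same argument gives
    lambda_2 = |lambda_2|.  The hypotheses lambda_1 <> lambda_2 and
    lambda_2 <> lambda_3 then make the inequalities strict: if lambda_2 were 0
    then lambda_3, of no larger modulus, would be 0 too.  The strict property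
    implies the non-strict one because S^- <= S^+. *)

Set Implicit Arguments.
Unset Strict Implicit.

Local Open Scope ring_scope.

Local Notation rootprod l := (\prod_(z <- l) ('X - z%:P)).

(** * Positive linear recurrences have a dominant positive root *)

(** Partial sums of the absolute series of the moments of f at the point 1 / a.
    Poles of the moment series are detected by letting a decrease to the
    modulus r of a root. *)
Definition weighted_sum (R : realType) (phi : {scalar {poly R[i]}}) (a : R[i])
    (f : {poly R[i]}) (T : nat) : R[i] :=
  \sum_(t < T) `|phi ('X^t * f)| / a ^+ t.

(** The passage to the limit in the truncation order T; the order of R[i]
    compares only numbers with the same imaginary part, so it reduces to a
    limit of real sequences. *)
Lemma le_of_geometric_gap (R : realType) (x B K rho : R[i]) (T0 : nat) :
  0 <= rho < 1 -> 0 <= K ->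
  (forall T, (T0 <= T)%N -> x <= B + K * rho ^+ T) -> x <= B.
Proof.
move=> /andP[rho0 rho1] K0 H.
have [r rE] : exists r, rho = (r%:C)%C by apply/complex_realP/ger0_real.
have [k kE] : exists k, K = (k%:C)%C by apply/complex_realP/ger0_real.
move: rho0 rho1 K0 H; rewrite {}rE {}kE.
rewrite (_ : 0 = (0%:C)%C :> R[i]) // (_ : 1 = (1%:C)%C :> R[i]) //.
rewrite !lecR ltcR => r0 r1 k0 H.
have HT T : (T0 <= T)%N ->
    (complex.Im B == complex.Im x) &&
    (complex.Re x <= complex.Re B + k * r ^+ T).
  move=> /H; rewrite -rmorphXn -rmorphM lecE /=.
  by case: x B {H} => [x1 x2] [B1 B2] /=; rewrite addr0.
rewrite lecE; have /andP[-> _] := HT T0 (leqnn _) => /=.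
have cv : ((fun T => complex.Re B + k * r ^+ T) @ \oo -->
    complex.Re B + k * 0)%classic.
  apply: cvgD; first exact: cvg_cst.
  by apply: cvgM; [exact: cvg_cst | apply: cvg_expr; rewrite ger0_norm].
rewrite mulr0 addr0 in cv.
apply: (cvgr_to_ge cv).
by exists T0 => // T /= /HT /andP[].
Qed.

(** Each root mu adds a recurrence u_(t+1) = mu u_t + w_t, and a geometric bound
    K a^t on w persists for u, with constant |u_0| + K / (a - |mu|), because
    |mu| < a. *)
Lemma growth_bound (R : realType) (phi : {scalar {poly R[i]}}) (a : R[i])
    (l : seq R[i]) (f : {poly R[i]}) :
  0 < a -> (forall z, z \in l -> `|z| < a) ->
  (forall g, phi (g * (rootprod l * f)) = 0) ->
  exists2 K, 0 <= K & forall t, `|phi ('X^t * f)| <= K * a ^+ t.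
Proof.
move=> a0; elim: l f => [|mu l IH] f hl ann.
  exists 0 => // t; rewrite mul0r.
  by have := ann ('X^t); rewrite big_nil mul1r => ->; rewrite normr0.
have [||K K0 HK] := IH (('X - mu%:P) * f).
- by move=> z zl; apply: hl; rewrite inE zl orbT.
- by move=> g; rewrite -(ann g) big_cons; congr (phi _); ring.
have hmu : 0 < a - `|mu| by rewrite subr_gt0 hl // inE eqxx.
exists (`|phi f| + K / (a - `|mu|)).
  by rewrite addr_ge0 ?divr_ge0 // ltW.
elim=> [|t IHt]; first by rewrite expr0 mul1r mulr1 lerDl divr_ge0 // ltW.
have -> : 'X^(t.+1) * f = mu *: ('X^t * f) + 'X^t * (('X - mu%:P) * f).
  by rewrite -mul_polyC exprS; ring.
rewrite linearD linearZ /=; apply: le_trans (ler_normD _ _) _.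
rewrite normrM.
apply: le_trans (lerD (ler_wpM2l (normr_ge0 mu) IHt) (HK t)) _.
set u := `|phi f|.
have at0 : 0 <= a ^+ t by rewrite exprn_ge0 // ltW.
rewrite mulrA -mulrDl exprS mulrA ler_wpM2r //.
have -> : (u + K / (a - `|mu|)) * a
   = `|mu| * (u + K / (a - `|mu|)) + K + u * (a - `|mu|).
  by field; rewrite gt_eqF.
by rewrite lerDl; apply: mulr_ge0; [exact: normr_ge0 | exact: ltW].
Qed.

(** The rational expression of the moment series at 1 / a, truncated at T:
    modulo q the constant c equals g (a - 'X), and multiplication by 'X - a
    becomes a difference of consecutive terms once the moments are divided by
    a ^+ t. *)
Lemma telescoping_sum (R : realType) (phi : {scalar {poly R[i]}}) (a c : R[i])
    (q g f : {poly R[i]}) (T : nat) :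
  a != 0 -> q = g * ('X - a%:P) + c%:P -> (forall h, phi (h * (q * f)) = 0) ->
  c * (\sum_(t < T) phi ('X^t * f) / a ^+ t)
    = a * (phi (g * f) - phi ('X^T * (g * f)) / a ^+ T).
Proof.
move=> a0 qE ann; elim: T => [|T IH].
  by rewrite big_ord0 mulr0 expr0 mul1r divr1 subrr mulr0.
rewrite big_ord_recr /= mulrDr IH.
have H : phi ('X^(T.+1) * (g * f) + (- a) *: ('X^T * (g * f))
    + c *: ('X^T * f)) = 0.
  by rewrite -(ann 'X^T); congr (phi _); rewrite qE -!mul_polyC exprS; ring.
rewrite 2!linearD !linearZ /= in H.
have -> : phi ('X^(T.+1) * (g * f))
   = a * phi ('X^T * (g * f)) - c * phi ('X^T * f).
  by apply/eqP; rewrite -subr_eq0 -H; apply/eqP; ring.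
by rewrite exprS; field; rewrite a0 expf_neq0.
Qed.

(** Uniformity in a of the numerator of the rational expression: the quotient of
    q = rootprod l by 'X - a has coefficients polynomial in a.  Adding the
    factor 'X - mu changes the quotient g into q + (a - mu) g, which gives the
    bound without writing these coefficients. *)
Lemma bounded_quotient (R : realType) (phi : {scalar {poly R[i]}}) (M : R[i])
    (l : seq R[i]) (f : {poly R[i]}) :
  0 <= M ->
  exists2 B, 0 <= B & forall a, `|a| <= M ->
    exists2 g, rootprod l = g * ('X - a%:P) + ((rootprod l).[a])%:P &
      `|phi (g * f)| <= B.
Proof.
move=> M0; elim: l => [|mu l [B B0 HB]].
  exists 0 => // a _; exists 0; first by rewrite big_nil hornerC mul0r add0r.
  by rewrite mul0r linear0 normr0.
exists (`|phi (rootprod l * f)| + (M + `|mu|) * B).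
  by rewrite addr_ge0 // mulr_ge0 // addr_ge0.
move=> a aM; have [g gE gB] := HB a aM.
exists (rootprod l + (a - mu) *: g).
  rewrite big_cons hornerM hornerXsubC polyCM polyCB -mul_polyC polyCB.
  move: gE; set c := (rootprod l).[a]; clearbody c => gE.
  rewrite (_ : c%:P = rootprod l - g * ('X - a%:P)); first by ring.
  by rewrite gE; ring.
rewrite mulrDl -scalerAl linearD linearZ /=; apply: le_trans (ler_normD _ _) _.
rewrite lerD2l normrM ler_pM //.
by apply: le_trans (ler_normB _ _) _; rewrite lerD2r.
Qed.

(** Since |z| <= r <= a, the distance a - r is at most |a - z|, whence
    |r - z| <= 2 |a - z|: the denominator stays away from 0 near r. *)
Lemma rootprod_horner_lbound (R : realType) (r : R[i]) (l : seq R[i]) :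
  (forall z, z \in l -> `|z| <= r) -> r \notin l ->
  exists2 d, 0 < d & forall a, r <= a -> d <= `|(rootprod l).[a]|.
Proof.
elim: l => [|mu l IH] hl rl.
  by exists 1 => // a _; rewrite big_nil hornerC normr1.
move: rl; rewrite inE negb_or => /andP[rmu rl].
have [z zl||d d0 Hd] := IH; first by apply: hl; rewrite inE zl orbT.
  by [].
exists (`|r - mu| / 2 * d).
  by rewrite mulr_gt0 // divr_gt0 // normr_gt0 subr_eq0.
move=> a ra; rewrite big_cons hornerM hornerXsubC normrM.
apply: ler_pM; rewrite ?Hd ?(ltW d0) //.
rewrite ler_pdivrMr //.
have mur : `|mu| <= r by apply: hl; rewrite inE eqxx.
have a0 : 0 <= a by apply: le_trans ra; apply: le_trans mur.
have h1 : a - r <= `|a - mu|.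
  apply: le_trans (lerB_dist _ _); rewrite ger0_norm //.
  by rewrite lerD2l lerN2.
have : `|r - mu| <= `|a - mu| + `|a - r|.
  by rewrite (_ : r - mu = (a - mu) - (a - r)) ?ler_normB //; ring.
move=> /le_trans; apply.
by rewrite mulr_natr mulr2n lerD2l [`|a - r|]ger0_norm ?subr_ge0.
Qed.

(** For nonnegative moments the absolute sums are the sums themselves, and the
    telescoped expression bounds them.  The bound B does not depend on a: this
    says that the series has no singularity at 1 / r. *)
Lemma nonneg_weighted_sum_bounded (R : realType)
    (phi : {scalar {poly R[i]}}) (l : seq R[i]) (f : {poly R[i]}) (r : R[i]) :
  0 < r -> (forall z, z \in l -> `|z| <= r) -> r \notin l ->
  (forall g, phi (g * (rootprod l * f)) = 0) ->
  (forall t, 0 <= phi ('X^t * f)) ->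
  exists2 B, 0 <= B &
    forall a T, r < a <= r + 1 -> weighted_sum phi a f T <= B.
Proof.
move=> r0 lr rl ann f0.
have r10 : 0 <= r + 1 by rewrite addr_ge0 // ltW.
have [B B0 HB] := bounded_quotient phi l f r10.
have [d d0 Hd] := rootprod_horner_lbound lr rl.
exists ((r + 1) * B / d) => [|a T /andP[ra ar]].
  by rewrite divr_ge0 ?mulr_ge0 // ltW.
have a0 : 0 < a by apply: lt_trans ra.
have aM : `|a| <= r + 1 by rewrite gtr0_norm.
have [g gE gB] := HB a aM.
have [K K0 HK] : exists2 K, 0 <= K &
    forall t, `|phi ('X^t * (g * f))| <= K * ((r + a) / 2) ^+ t.
  (* A rate strictly between r and a makes the remainder at T decay. *)
  apply: (@growth_bound _ _ _ l).
  - by rewrite divr_gt0 // addr_gt0.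
  - by move=> z /lr zr; apply: le_lt_trans zr _;
    rewrite ltr_pdivlMr // mulr_natr mulr2n ltrD2l.
  - by move=> h; rewrite -(ann (h * g)); congr (phi _); ring.
rewrite ler_pdivlMr // mulrC.
pose rho := (r + a) / 2 / a.
apply: (@le_of_geometric_gap _ _ _ ((r + 1) * K) rho T).
- rewrite divr_ge0 ?divr_ge0 ?addr_ge0 ?ltW //=.
  by rewrite ltr_pdivrMr // mul1r ltr_pdivrMr // mulr_natr mulr2n ltrD2r.
- by rewrite mulr_ge0.
move=> T' TT'.
have S0 U : weighted_sum phi a f U = \sum_(t < U) phi ('X^t * f) / a ^+ t.
  by apply: eq_bigr => t _; rewrite ger0_norm.
have mono : weighted_sum phi a f T <= weighted_sum phi a f T'.
  rewrite /weighted_sum -(subnKC TT') big_split_ord /= lerDl.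
  by apply: sumr_ge0 => t _; rewrite divr_ge0 // exprn_ge0 // ltW.
have W0 : 0 <= weighted_sum phi a f T'.
  by apply: sumr_ge0 => t _; rewrite divr_ge0 // exprn_ge0 // ltW.
apply: le_trans (_ : d * weighted_sum phi a f T' <= _).
  by rewrite ler_wpM2l // ltW.
apply: le_trans (_ : `|(rootprod l).[a]| * weighted_sum phi a f T' <= _).
  by rewrite ler_wpM2r // Hd // ltW.
rewrite -{1}(ger0_norm W0) -normrM S0.
rewrite (telescoping_sum T' _ gE ann) ?gt_eqF // normrM gtr0_norm //.
rewrite -mulrA -mulrDr ler_pM ?(ltW a0) //.
apply: le_trans (ler_normB _ _) _; rewrite lerD // normrM normfV.
rewrite normrX [`|a|]gtr0_norm // ler_pdivrMr ?exprn_gt0 //.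
apply: le_trans (HK T') _.
by rewrite -mulrA -exprMn /rho divfK // gt_eqF.
Qed.

(** A polynomial multiple of f inherits bounded absolute sums: one factor
    'X - mu combines the moments at t and t + 1, and costs a + |mu|. *)
Lemma weighted_sum_rootprod (R : realType) (phi : {scalar {poly R[i]}})
    (a B : R[i]) (l : seq R[i]) (f : {poly R[i]}) (T : nat) :
  0 < a -> (forall T, weighted_sum phi a f T <= B) ->
  weighted_sum phi a (rootprod l * f) T <= (\prod_(z <- l) (a + `|z|)) * B.
Proof.
move=> a0 HB; elim: l T => [|mu l IH] T; first by rewrite !big_nil !mul1r.
rewrite !big_cons -mulrA; set F := rootprod l * f; set C := \prod_(z <- l) _.
have -> : (a + `|mu|) * C * B = a * (C * B) + `|mu| * (C * B) by ring.
have term t : `|phi ('X^t * (('X - mu%:P) * F))| / a ^+ t <=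
   a * (`|phi ('X^(t.+1) * F)| / a ^+ t.+1) +
   `|mu| * (`|phi ('X^t * F)| / a ^+ t).
  have -> : 'X^t * (('X - mu%:P) * F) = 'X^(t.+1) * F + (- mu) *: ('X^t * F).
    by rewrite -mul_polyC exprS; ring.
  rewrite linearD linearZ /= mulNr.
  have -> : a * (`|phi ('X^(t.+1) * F)| / a ^+ t.+1)
      + `|mu| * (`|phi ('X^t * F)| / a ^+ t)
    = (`|phi ('X^(t.+1) * F)| + `|mu| * `|phi ('X^t * F)|) / a ^+ t.
    by rewrite [a ^+ t.+1]exprS; field; rewrite expf_neq0 gt_eqF.
  rewrite ler_wpM2r ?invr_ge0 ?exprn_ge0 ?(ltW a0) // -normrM.
  exact: ler_normB.
apply: (@le_trans _ _ (a * weighted_sum phi a F T.+1 +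
    `|mu| * weighted_sum phi a F T)).
  apply: (@le_trans _ _ (\sum_(t < T)
      (a * (`|phi ('X^(t.+1) * F)| / a ^+ t.+1) +
       `|mu| * (`|phi ('X^t * F)| / a ^+ t)))).
    by apply: ler_sum => t _; exact: term.
  rewrite big_split /= -!mulr_sumr lerD2r ler_wpM2l ?(ltW a0) //.
  by rewrite /weighted_sum big_ord_recl /= lerDr divr_ge0 // exprn_ge0 // ltW.
by apply: lerD; apply: ler_wpM2l; rewrite ?(ltW a0) //; apply: IH.
Qed.

Lemma moment_of_eigenvector (R : realType) (phi : {scalar {poly R[i]}})
    (mu : R[i]) (F : {poly R[i]}) (t : nat) :
  (forall g, phi (g * (('X - mu%:P) * F)) = 0) ->
  phi ('X^t * F) = mu ^+ t * phi F.
Proof.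
move=> ann; elim: t => [|t IH]; first by rewrite !expr0 !mul1r.
have := ann 'X^t.
have -> : 'X^t * (('X - mu%:P) * F) = 'X^(t.+1) * F + (- mu) *: ('X^t * F).
  by rewrite -mul_polyC exprS; ring.
rewrite linearD linearZ /= mulNr IH => /eqP; rewrite subr_eq0 => /eqP ->.
by rewrite exprS mulrA.
Qed.

(** Let F be f times the product over l without mu.  The moments of F are
    phi F * mu^t, whose absolute series at 1 / a is |phi F| / (1 - r / a) and
    blows up as a decreases to r, whereas the previous lemmas bound it uniformly
    in a.  Hence the residue phi F is 0. *)
Lemma dominant_cofactor_vanishes (R : realType)
    (phi : {scalar {poly R[i]}}) (l : seq R[i]) (f : {poly R[i]}) (mu : R[i]) :
  mu \in l -> mu != 0 -> (forall z, z \in l -> `|z| <= `|mu|) ->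
  `|mu| \notin l ->
  (forall g, phi (g * (rootprod l * f)) = 0) ->
  (forall t, 0 <= phi ('X^t * f)) ->
  phi (rootprod (rem mu l) * f) = 0.
Proof.
move=> mul mu0 lr rl ann f0.
set F := _ * f; set r := `|mu|.
have r0 : 0 < r by rewrite normr_gt0.
have [B B0 HB] := nonneg_weighted_sum_bounded r0 lr rl ann f0.
have modal : forall t, phi ('X^t * F) = mu ^+ t * phi F.
  move=> t; apply: moment_of_eigenvector => g.
  by rewrite -(ann g) (big_rem _ mul) /= -mulrA.
pose D := \prod_(z <- rem mu l) (r + 1 + `|z|).
have D0 : 0 <= D.
  by apply: prodr_ge0 => z _; rewrite addr_ge0 // addr_ge0 // ltW.
have bnd a : r < a <= r + 1 -> `|phi F| <= D * B * (a - r) / r.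
  move=> /andP[ra ar]; have a0 : 0 < a := lt_trans r0 ra.
  have ra1 : 0 <= r / a < 1 by rewrite divr_ge0 ?ltW //= ltr_pdivrMr // mul1r.
  apply: (@le_of_geometric_gap _ _ _ `|phi F| (r / a) 0) => // T _.
  have sumE : weighted_sum phi a F T * (1 - r / a)
      = `|phi F| * (1 - (r / a) ^+ T).
    have -> : 1 - (r / a) ^+ T = (1 - r / a) * (\sum_(t < T) (r / a) ^+ t).
      by rewrite -[LHS]opprB subrX1; ring.
    rewrite mulrCA mulrC.
    congr (_ * _); rewrite mulr_sumr; apply: eq_bigr => t _.
    by rewrite modal normrM normrX expr_div_n mulrAC mulrC.
  (* |phi F| is the geometric sum times 1 - r / a, up to a vanishing term. *)
  rewrite [leLHS](_ : _ = weighted_sum phi a F T * (1 - r / a)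
      + `|phi F| * (r / a) ^+ T); last by rewrite sumE; ring.
  have WD : weighted_sum phi a F T <= D * B.
    apply: le_trans (weighted_sum_rootprod (rem mu l) T a0 (B := B) _) _.
      by move=> U; apply: HB; rewrite ra.
    rewrite ler_wpM2r // /D; elim: (rem mu l) => [|z s IHs].
      by rewrite !big_nil.
    rewrite !big_cons ler_pM ?lerD2r //; first by rewrite addr_ge0 // ltW.
    by apply: prodr_ge0 => x _; rewrite addr_ge0 // ltW.
  rewrite lerD2r; apply: le_trans (_ : D * B * (1 - r / a) <= _).
    by rewrite ler_wpM2r // subr_ge0 ltW //; case/andP: ra1.
  rewrite -[X in _ <= X]mulrA ler_wpM2l ?mulr_ge0 //.
  rewrite (_ : 1 - r / a = (a - r) / a); last by field; rewrite gt_eqF.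
  by rewrite ler_wpM2l ?subr_ge0 ?(ltW ra) // lef_pV2 ?posrE ?(ltW ra).
apply/eqP; rewrite -normr_eq0; apply: contraT => w0.
set w := `|phi F| in bnd w0; have {}w0 : 0 < w by rewrite lt_def w0 normr_ge0.
pose k := D * B / r.
have k0 : 0 <= k by rewrite divr_ge0 ?mulr_ge0 // ltW.
have wk0 : 0 < w + k by rewrite ltr_wpDr.
(* A value of a so close to r that the bound drops below w. *)
have /bnd : r < r + w / (w + k) <= r + 1.
  by rewrite ltrDl divr_gt0 //= lerD2l ler_pdivrMr // mul1r lerDl.
rewrite [_ + _ - r]addrC addKr.
have -> : D * B * (w / (w + k)) / r = D * B / r * w / (w + k) by ring.
rewrite -/k.
rewrite ler_pdivlMr // mulrDr [k * w]mulrC gerDr.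
move=> /(lt_le_trans (mulr_gt0 w0 w0)).
by rewrite ltxx.
Qed.

(** If |mu| were not in l, the cofactor of 'X - mu in the generator of the
    annihilator would itself be annihilated, although its degree is smaller. *)
Lemma dominant_modulus_is_root (R : realType) (phi : {scalar {poly R[i]}})
    (l : seq R[i]) (p : {poly R[i]}) (mu : R[i]) (T0 : nat) :
  (forall f, (forall t, phi ('X^t * f) = 0) <-> rootprod l * p %| f) ->
  p != 0 -> (forall t, (T0 <= t)%N -> 0 <= phi ('X^t * p)) ->
  mu \in l -> (forall z, z \in l -> `|z| <= `|mu|) -> `|mu| \in l.
Proof.
move=> annP p0 pos mul lmu; have [E|mu0] := eqVneq mu 0.
  by move: mul; rewrite E normr0.
apply: contraT => rl.
have ann f : rootprod l * p %| f -> phi f = 0.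
  by move=> /annP /(_ 0%N); rewrite expr0 mul1r.
set F := rootprod (rem mu l) * p.
have lF : rootprod l * p = ('X - mu%:P) * F.
  by rewrite (big_rem _ mul) /= -mulrA.
have annF g : phi (g * (('X - mu%:P) * F)) = 0.
  by apply: ann; rewrite lF dvdp_mull.
have : phi (rootprod (rem mu l) * ('X^T0 * p)) = 0.
  (* The factor 'X^T0 shifts away the terms of unknown sign. *)
  apply: dominant_cofactor_vanishes => // [g|t].
    by apply: ann; rewrite mulrA mulrCA -mulrA 2?dvdp_mull.
  by rewrite mulrA -exprD pos // leq_addl.
rewrite mulrCA -/F (moment_of_eigenvector _ annF) => /eqP.
rewrite mulf_eq0 expf_eq0 (negbTE mu0) andbF /= => /eqP F0.
have : rootprod l * p %| F.
  by apply/annP => t; rewrite (moment_of_eigenvector _ annF) F0 mulr0.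
have Fn0 : F != 0 by rewrite mulf_neq0 // monic_neq0 // monic_prod_XsubC.
move=> /(dvdp_leq Fn0); rewrite lF size_monicM ?monicXsubC // size_XsubC.
by rewrite add2n ltnn.
Qed.

(** * Sign changes of the outputs of two-tap inputs *)

(** A nonzero entry strictly between i and j is opposite in sign to one of the
    two ends, so the interval can be shrunk until only zeros are left inside. *)
Lemma sign_change_between (R : realType) (u : nat -> R) (i j : nat) :
  (i < j)%N -> u i * u j < 0 -> exists2 p, sign_changes u p & (i <= p.1)%N.
Proof.
have [m] := ubnP (j - i); elim: m i j => // m IH i j jim ij uij.
have [[k /andP[ik kj] uk0]|none] :=
  pselect (exists2 k, (i < k < j)%N & u k != 0);
  last first.
  exists (i, j) => //; split=> // k ikj; apply/eqP; apply: contraT => uk0.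
  by exfalso; apply: none; exists k.
have [uik|uik] := ltP (u i * u k) 0.
  by apply: (IH i k) => //; lia.
have ukj : u k * u j < 0.
  have ui0 : u i != 0 by apply: contraTneq uij => ->; rewrite mul0r ltxx.
  have {}uik : 0 < u i * u k by rewrite lt_def uik mulf_neq0.
  have : (u i * u k) * (u k * u j) < 0.
    rewrite (_ : _ * _ = u k ^+ 2 * (u i * u j)); last by ring.
    by rewrite pmulr_rlt0 // exprn_even_gt0.
  by rewrite pmulr_rlt0.
have jkm : (j - k < m)%N by lia.
have [p pS kp] := IH k j jkm kj ukj.
by exists p => //; apply: leq_trans kp; apply: ltnW.
Qed.

Lemma finite_sign_changes_eventually_signed (R : realType) (u : nat -> R) :
  finite_set (sign_changes u) ->
  exists T, (forall t, (T <= t)%N -> 0 <= u t) \/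
            (forall t, (T <= t)%N -> u t <= 0).
Proof.
move=> /finite_seqP[s sE]; exists (\max_(p <- s) p.1).+1.
have late p : sign_changes u p -> (p.1 < (\max_(p <- s) p.1).+1)%N.
  by rewrite sE ltnS => ps; rewrite (big_rem p ps) leq_maxl.
apply: contrapT => /not_orP[/existsNP[i /not_implyP[Ti /negP]]].
rewrite -ltNge => ui /existsNP[j /not_implyP[Tj /negP]]; rewrite -ltNge => uj.
have [ij|ji|E] := ltngtP i j;
  last by move: ui uj; rewrite E => ui; rewrite ltNge ltW.
- have [|p pS] := @sign_change_between R u i j ij; first by rewrite nmulr_rlt0.
  by move=> pge; have := leq_ltn_trans (leq_trans Ti pge) (late p pS);
    rewrite ltnn.
- have [|p pS] := @sign_change_between R u j i ji; first by rewrite nmulr_llt0.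
  by move=> pge; have := leq_ltn_trans (leq_trans Tj pge) (late p pS);
    rewrite ltnn.
Qed.

Lemma Sminus_finite (R : realType) (u : nat -> R) (k : R) :
  (Sminus u <= k%:E)%E -> finite_set (sign_changes u).
Proof.
rewrite /Sminus; case: asboolP => [-> _|_].
  rewrite (_ : sign_changes _ = set0)%classic; first exact: finite_set0.
  by apply/seteqP; split=> // p [_ /=]; rewrite mul0r ltxx.
by rewrite /counting; case: asboolP => //; rewrite leye_eq.
Qed.

(** The input u(-1) = al, u(-2) = be: two entries leave room for one sign
    change only. *)
Definition two_tap (R : realType) (al be : R) : nat -> R :=
  fun j => if j is 0 then al else if j is 1 then be else 0.

Lemma two_tap_Sminus (R : realType) (al be : R) :
  (Sminus (two_tap al be) <= 1%:R%:E)%E.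
Proof.
rewrite /Sminus; case: asboolP => _; first by rewrite lee_fin; lra.
have : (sign_changes (two_tap al be) `<=` [set (0%N, 1%N)])%classic.
  case=> [[|[|i]] [|[|j]]] [//= _]; rewrite ?mulr0 ?mul0r ?ltxx //.
move=> /subset_set1[] ->; rewrite /counting asboolT ?fset_set0 ?fset_set1 //.
by rewrite finmap.cardfs1.
Qed.

Lemma hankel_two_tap (R : realType) (g : nat -> R) (al be : R) (t : nat) :
  (series (hankel_terms g (two_tap al be) t) @ \oo -->
     al * g t.+1 + be * g t.+2)%classic.
Proof.
apply: cvg_near_cst; exists 2%N => // N /= N2.
rewrite /series /= (@big_cat_nat _ _ _ 2) //= big_nat_recr //= big_nat1.
rewrite [X in _ + X]big_nat big1 ?addr0 => [|j /andP[]]; last first.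
  by case: j => [|[|j]] // _ _; rewrite /hankel_terms /= mulr0.
by rewrite /hankel_terms /= addn1 addn2 mulrC [be * _]mulrC.
Qed.

Lemma two_tap_output_eventually_signed (R : realType) (g : nat -> R)
    (al be : R) :
  variation_bounding 1 (hankel_dom g) (hankel g) ->
  (al != 0) || (be != 0) ->
  exists T, (forall t, (T <= t)%N -> 0 <= al * g t.+1 + be * g t.+2) \/
            (forall t, (T <= t)%N -> al * g t.+1 + be * g t.+2 <= 0).
Proof.
move=> vb ab0.
have hE : hankel g (two_tap al be) = fun t => al * g t.+1 + be * g t.+2.
  by apply/funext => t; apply: cvg_lim => //; exact: hankel_two_tap.
have dom : hankel_dom g (two_tap al be).
  by move=> t; apply/cvg_ex; eexists; exact: hankel_two_tap.
have nz : two_tap al be <> (fun=> 0).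
  move=> E; move: ab0.
  by rewrite -[al]/(two_tap al be 0) -[be]/(two_tap al be 1) E eqxx.
have := Sminus_finite (vb _ dom nz (two_tap_Sminus al be)).
by rewrite hE => /finite_sign_changes_eventually_signed.
Qed.

Lemma strictly_variation_bounding_weaken (R : realType) (k : nat)
    (D : set (nat -> R)) (X : (nat -> R) -> nat -> R) :
  strictly_variation_bounding k D X -> variation_bounding k D X.
Proof.
move=> H u Du u0 /(H u Du u0); apply: le_trans.
by apply: ereal_sup_ubound; exists (X u).
Qed.

(** * The moment functional of a minimal realization *)

Lemma map_mx_expr (R S : comNzRingType) (f : {rmorphism R -> S}) (n' : nat)
    (A : 'M[R]_n'.+1) (t : nat) :
  map_mx f (A ^+ t) = map_mx f A ^+ t.
Proof. exact: rmorphXn. Qed.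

(** The transpose of the controllability matrix, so that polynomials of degree
    less than n act as row vectors. *)
Definition krylov (F : comNzRingType) (n' : nat) (A : 'M[F]_n'.+1)
    (b : 'cV[F]_n'.+1) : 'M[F]_n'.+1 :=
  \matrix_(i, j) (A ^+ i *m b) j 0.

Lemma horner_krylov (F : comNzRingType) (n' : nat) (A : 'M[F]_n'.+1)
    (b : 'cV[F]_n'.+1) (u : 'rV[F]_n'.+1) :
  (horner_mx A (rVpoly u) *m b)^T = u *m krylov A b.
Proof.
have -> : horner_mx A (rVpoly u) = \sum_i u 0 i *: A ^+ i.
  rewrite {1}[u]row_sum_delta linear_sum /= linear_sum /=.
  apply: eq_bigr => i _.
  by rewrite !linearZ /= rVpoly_delta rmorphXn /= horner_mx_X.
rewrite mulmx_suml; apply/rowP => j; rewrite mxE summxE [RHS]mxE.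
by apply: eq_bigr => i _; rewrite -scalemxAl !mxE.
Qed.

(** Every reachable state is g(A) b for a polynomial g, which can be reduced
    modulo the characteristic polynomial by Cayley-Hamilton; so the Krylov rows
    span the whole space. *)
Lemma controllable_krylov_unit (R : realType) (n' : nat) (A : 'M[R]_n'.+1)
    (b : 'cV[R]_n'.+1) :
  controllable A b -> krylov A b \in unitmx.
Proof.
move=> ctrl; rewrite -row_full_unit -sub1mx; apply/row_subP => i.
have [T [u uT]] := ctrl 0 (row i 1%:M)^T.
have reach s : exists g : {poly R}, state A b 0 u s = horner_mx A g *m b.
  elim: s => [|s [g gE]]; first by exists 0; rewrite rmorph0 mul0mx.
  exists ('X * g + (u s)%:P).
  rewrite /= gE rmorphD rmorphM /= horner_mx_X horner_mx_C.
  by rewrite mulmxDl mulmxA mul_scalar_mx.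
have [g gE] := reach T.
have modE : horner_mx A g = horner_mx A (g %% char_poly A).
  rewrite {1}(divp_eq g (char_poly A)) rmorphD rmorphM /= Cayley_Hamilton.
  by rewrite mulr0 add0r.
have sz : (size (g %% char_poly A)%R <= n'.+1)%N.
  rewrite -ltnS -(size_char_poly A) ltn_modp.
  by rewrite monic_neq0 // char_poly_monic.
apply/submxP; exists (poly_rV (g %% char_poly A)).
by rewrite -horner_krylov poly_rV_K // -modE -gE uT trmxK.
Qed.

(** Observability is a statement about real states; a complex state is treated
    through its real and imaginary parts. *)
Lemma observable_complex (R : realType) (n' : nat) (A : 'M[R]_n'.+1)
    (b : 'cV[R]_n'.+1) (c : 'rV[R]_n'.+1) (w : 'cV[R[i]]_n'.+1) :
  observable A b c ->
  (forall t, map_mx (real_complex R) c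
     *m (map_mx (real_complex R) A ^+ t *m w) = 0) -> w = 0.
Proof.
move=> obs w0.
have free x t : state A b x (fun=> 0) t = A ^+ t *m x.
  elim: t => [|t IH]; first by rewrite expr0 mul1mx.
  by rewrite /= IH scale0r addr0 exprS mulmxA.
have obs0 (x : 'cV_n'.+1) : (forall t, c *m (A ^+ t *m x) = 0) -> x = 0.
  move=> x0; apply: (obs (fun=> 0) x 0) => t.
  by rewrite /output !free x0 !mulmx0.
have re t : c *m (A ^+ t *m map_mx (@complex.Re R) w) = 0 /\
            c *m (A ^+ t *m map_mx (@complex.Im R) w) = 0.
  have := w0 t; rewrite -map_mx_expr mulmxA -map_mxM => /matrixP /(_ 0 0).
  rewrite !mxE => E.
  have [E1 E2] : \sum_j (c *m A ^+ t) 0 j * complex.Re (w j 0) = 0 /\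
                 \sum_j (c *m A ^+ t) 0 j * complex.Im (w j 0) = 0.
    split.
      move/(congr1 (@complex.Re R)): E; rewrite raddf_sum /= => E.
      rewrite -[RHS]E.
      apply: eq_bigr => j _; rewrite [in RHS]mxE; case: (w j 0) => x y /=.
      by rewrite mul0r subr0.
    move/(congr1 (@complex.Im R)): E; rewrite raddf_sum /= => E.
    rewrite -[RHS]E.
    apply: eq_bigr => j _; rewrite [in RHS]mxE; case: (w j 0) => x y /=.
    by rewrite mul0r addr0.
  split; rewrite mulmxA; apply/matrixP => i j; rewrite !ord1 mxE [RHS]mxE.
    by rewrite -[RHS]E1; apply: eq_bigr => k _; rewrite !mxE.
  by rewrite -[RHS]E2; apply: eq_bigr => k _; rewrite !mxE.
have wr := obs0 _ (fun t => proj1 (re t)).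
have wi := obs0 _ (fun t => proj2 (re t)).
apply/colP => i; rewrite [RHS]mxE.
move/colP/(_ i): wr; move/colP/(_ i): wi; rewrite !mxE.
by case: (w i 0) => x y /= -> ->.
Qed.

Definition moment (R : realType) (n' : nat) (A : 'M[R]_n'.+1)
    (b : 'cV[R]_n'.+1) (c : 'rV[R]_n'.+1) (f : {poly R[i]}) : R[i] :=
  (map_mx (real_complex R) c *m
    (horner_mx (map_mx (real_complex R) A) f *m map_mx (real_complex R) b)) 0 0.

Lemma moment_is_scalar (R : realType) (n' : nat) (A : 'M[R]_n'.+1)
    (b : 'cV[R]_n'.+1) (c : 'rV[R]_n'.+1) : scalar (moment A b c).
Proof.
move=> a f g; rewrite /moment linearP /= mulmxDl mulmxDr -scalemxAl -scalemxAr.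
by rewrite mxE [X in X + _]mxE.
Qed.

HB.instance Definition _ (R : realType) (n' : nat) (A : 'M[R]_n'.+1)
    (b : 'cV[R]_n'.+1) (c : 'rV[R]_n'.+1) :=
  GRing.isLinear.Build R[i] {poly R[i]} R[i] *%R (moment A b c)
    (moment_is_scalar A b c).

Lemma moment_Xn (R : realType) (n' : nat) (A : 'M[R]_n'.+1)
    (b : 'cV[R]_n'.+1) (c : 'rV[R]_n'.+1) (t : nat) :
  moment A b c 'X^t = (real_complex R) (impulse_response A b c t.+1).
Proof.
rewrite /moment rmorphXn /= horner_mx_X -map_mx_expr mulmxA -!map_mxM mxE.
by [].
Qed.

(** Let r be the remainder of f modulo the characteristic polynomial.
    Observability turns the vanishing of the moments of r into r(A) b = 0, and
    controllability makes b, A b, ..., A^(n-1) b independent, so r = 0. *)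
Lemma moment_annihilator (R : realType) (n' : nat) (A : 'M[R]_n'.+1)
    (b : 'cV[R]_n'.+1) (c : 'rV[R]_n'.+1) (f : {poly R[i]}) :
  minimal_realization A b c ->
  (forall t, moment A b c ('X^t * f) = 0) <->
    char_poly (map_mx (real_complex R) A) %| f.
Proof.
move=> [ctrl obs]; set Ac := map_mx _ A; set chi := char_poly Ac.
have chi0 g : moment A b c (g * chi) = 0.
  by rewrite /moment rmorphM /= Cayley_Hamilton mulr0 mul0mx mulmx0 mxE.
split=> [f0|/dvdpP[g ->] t]; last by rewrite mulrA chi0.
set r := f %% chi; suff r0 : r = 0 by apply/modp_eq0P.
have sz : (size r <= n'.+1)%N.
  rewrite -ltnS -(size_char_poly Ac) ltn_modp.
  by rewrite monic_neq0 // char_poly_monic.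
have w0 : horner_mx Ac r *m map_mx (real_complex R) b = 0.
  apply: (observable_complex obs) => t.
  have : moment A b c ('X^t * r) = 0.
    have := f0 t; rewrite {1}(divp_eq f chi) mulrDr linearD /=.
    by rewrite mulrA chi0 add0r.
  rewrite /moment rmorphM /= rmorphXn /= horner_mx_X -mulmxA => E.
  by apply/matrixP => i j; rewrite !ord1 E mxE.
have Ku : krylov Ac (map_mx (real_complex R) b) \in unitmx.
  have -> : krylov Ac (map_mx (real_complex R) b)
      = map_mx (real_complex R) (krylov A b).
    by apply/matrixP => i j; rewrite mxE -map_mx_expr -map_mxM !mxE.
  by rewrite map_unitmx controllable_krylov_unit.
have : poly_rV r *m krylov Ac (map_mx (real_complex R) b) = 0 :> 'rV_n'.+1.
  by rewrite -horner_krylov poly_rV_K // w0 trmx0.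
move/(congr1 (mulmxr (invmx (krylov Ac (map_mx (real_complex R) b))))) => /=.
rewrite mulmxK // mul0mx => /(congr1 rVpoly).
by rewrite poly_rV_K // linear0.
Qed.

(** The two-tap output is the real sequence of moments of al + be 'X; replacing
    this polynomial by its opposite if necessary makes it eventually
    nonnegative. *)
Lemma dominant_mode (R : realType) (n' : nat) (A : 'M[R]_n'.+1)
    (b : 'cV[R]_n'.+1) (c : 'rV[R]_n'.+1) (l : seq R[i]) (al be : R)
    (mu : R[i]) :
  minimal_realization A b c ->
  variation_bounding 1 (hankel_dom (impulse_response A b c))
    (hankel (impulse_response A b c)) ->
  (al != 0) || (be != 0) ->
  char_poly (map_mx (real_complex R) A)
    = rootprod l * (((real_complex R) al)%:P + ((real_complex R) be)%:P * 'X) ->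
  mu \in l -> (forall z, z \in l -> `|z| <= `|mu|) -> `|mu| \in l.
Proof.
move=> hmin vb ab0; set p := _ + _ => chiE mul lmu.
have [T sgn] := two_tap_output_eventually_signed vb ab0.
have pE t : moment A b c ('X^t * p) = (real_complex R)
    (al * impulse_response A b c t.+1 + be * impulse_response A b c t.+2).
  have -> : 'X^t * p = (real_complex R) al *: 'X^t
      + (real_complex R) be *: 'X^(t.+1).
    by rewrite -!mul_polyC /p exprS; ring.
  by rewrite linearD !linearZ /= !moment_Xn rmorphD !rmorphM.
have p0 : p != 0.
  have : rootprod l * p != 0 by rewrite -chiE monic_neq0 // char_poly_monic.
  by apply: contraNneq => ->; rewrite mulr0.
have annP f : (forall t, moment A b c ('X^t * f) = 0) <-> rootprod l * p %| f.
  by rewrite -chiE; apply: moment_annihilator.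
case: sgn => sgn.
  apply: (dominant_modulus_is_root (T0 := T) annP p0) => // t Tt.
  by rewrite /= pE ler0c sgn.
apply: (@dominant_modulus_is_root _ (moment A b c) l (- p) mu T) => //.
- by move=> f; rewrite mulrN -scaleN1r dvdpZl ?oppr_eq0 ?oner_neq0 //;
  exact: annP.
- by rewrite oppr_eq0.
- by move=> t Tt; rewrite mulrN linearN /= pE oppr_ge0 lecR sgn.
Qed.

(** * The ordering of the eigenvalues *)

Lemma eig_geq_trans (R : realType) : transitive (@eig_geq R).
Proof.
move=> y x z; rewrite /eig_geq.
move=> /orP[xy|/andP[/eqP xy rxy]] /orP[yz|/andP[/eqP yz ryz]].
- by rewrite (lt_trans yz xy).
- by rewrite yz xy.
- by rewrite -xy yz.
- by rewrite yz xy eqxx (le_trans ryz rxy) orbT.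
Qed.

Lemma eig_geq_norm (R : realType) (z w : R[i]) : eig_geq z w -> `|w| <= `|z|.
Proof. by rewrite /eig_geq => /orP[/ltW|/andP[/eqP->]]. Qed.

(** Among the numbers of modulus |z|, the number |z| is the only one with the
    largest real part. *)
Lemma eig_geq_modulus (R : realType) (z : R[i]) : eig_geq z `|z| -> z = `|z|.
Proof.
rewrite /eig_geq normr_id ltxx eqxx /= => h.
have le1 : (complex.Re z) <= complex.Re `|z|.
  have := normc_ge_Re z; rewrite lecE => /andP[_ /=].
  by apply: le_trans; rewrite ler_norm.
have E : complex.Re z = complex.Re `|z| by apply/eqP; rewrite eq_le le1.
have := add_Re2_Im2 z.
move: E; rewrite normc_def => /= E.
rewrite -rmorphXn -E => /complexI /eqP; rewrite -subr_eq0 addrC addKr.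
rewrite sqrf_eq0 => /eqP Iz.
by case: z Iz {h le1 E} => x y /= ->.
Qed.

Unset Implicit Arguments.

Theorem corollary3 (R : realType) (n : nat) (hn : (3 <= n)%N)
  (A : 'M[R]_n) (b : 'cV[R]_n) (c : 'rV[R]_n)
  (hmin : minimal_realization A b c)
  (lam : seq R[i]) (hlam : ordered_eigenvalues A lam)
  (h12 : lam`_0 <> lam`_1) (h23 : lam`_1 <> lam`_2) :
  let g := impulse_response A b c in
  (variation_bounding 1 (hankel_dom g) (hankel g) ->
     [/\ lam`_0 \is Num.real, lam`_1 \is Num.real,
         lam`_1 < lam`_0 & 0 <= lam`_1]) /\
  (strictly_variation_bounding 1 (hankel_dom g) (hankel g) ->
     [/\ lam`_0 \is Num.real, lam`_1 \is Num.real,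
         lam`_1 < lam`_0 & 0 < lam`_1]).
Proof.
case: n hn A b c hmin hlam => // n' hn A b c hmin [chiE srt] g.
have sz : size lam = n'.+1.
  apply: succn_inj; rewrite -(size_char_poly (map_mx (real_complex R) A)) chiE.
  by rewrite size_prod_XsubC.
case: lam sz chiE srt h12 h23 => [|l0 [|l1 [|l2 s]]] /= sz chiE srt h12 h23.
- by [].
- by move: hn; rewrite -sz.
- by move: hn; rewrite -sz.
have /= /andP[g01 /andP[g12 _]] := srt.
have top0 z : z \in [:: l0, l1, l2 & s] -> eig_geq l0 z.
  rewrite inE => /predU1P[->|]; first by rewrite /eig_geq eqxx lexx orbT.
  by apply/allP/(order_path_min (@eig_geq_trans R)): z.
have top1 z : z \in [:: l1, l2 & s] -> eig_geq l1 z.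
  rewrite inE => /predU1P[->|]; first by rewrite /eig_geq eqxx lexx orbT.
  by move: z; apply/allP/(order_path_min (@eig_geq_trans R)); case/andP: srt.
have l1_neq0 : l1 != 0.
  apply/eqP => E; move: h23 (eig_geq_norm g12).
  rewrite E normr0 normr_le0 => h /eqP.
  by move=> E2; apply: h.
suff main : variation_bounding 1 (hankel_dom g) (hankel g) ->
    [/\ l0 \is Num.real, l1 \is Num.real, l1 < l0 & 0 <= l1].
  split=> // /strictly_variation_bounding_weaken /main[-> -> ->].
  by rewrite le_eqVlt eq_sym (negbTE l1_neq0).
move=> vb.
have E0 : l0 = `|l0|.
  apply/eig_geq_modulus/top0.
  apply: (@dominant_mode _ _ A b c _ 1 0) => //.
  - by rewrite oner_eq0.
  - by rewrite chiE rmorph1 rmorph0 mul0r addr0 mulr1.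
  - by rewrite inE eqxx.
  - by move=> z /top0 /eig_geq_norm.
have l0r : (real_complex R (complex.Re l0)) = l0.
  by apply: RRe_real; rewrite E0 normr_real.
(* The taps - l0 and 1 cancel the mode l0 of the impulse response. *)
have E1 : l1 = `|l1|.
  apply/eig_geq_modulus/top1.
  apply: (@dominant_mode _ _ A b c _ (- complex.Re l0) 1) => //.
  - by rewrite oner_eq0 orbT.
  - rewrite chiE big_cons mulrC; congr (_ * _).
    by rewrite rmorphN /= l0r rmorph1 mul1r polyCN addrC.
  - by rewrite inE eqxx.
  - by move=> z /top1 /eig_geq_norm.
have l0_real : l0 \is Num.real by rewrite E0 normr_real.
have l1_real : l1 \is Num.real by rewrite E1 normr_real.
split=> //; last by rewrite E1.
rewrite lt_neqAle; apply/andP; split; first by apply/eqP => E; apply: h12.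
by rewrite E0 E1; apply: eig_geq_norm.
Qed.
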